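(* Let $\mathbf{A}\in\mathbb{R}^{n\times d}$, $\mathbf{A}^\top\mathbf{A}$ with eigenvalues $\lambda_1>\lambda_2\ge\dots$, $\mathrm{gap}=(\lambda_1-\lambda_2)/\lambda_1$. Consider the following algorithm with parameter $\alpha$ and $t=c\alpha\log d$. Draw $W=[w_1,w_2]$ with i.i.d. $\mathcal{N}(0,1)$ entries and set $[\tilde\lambda^{(0)}_1,\tilde\lambda^{(0)}_2]=\mathrm{eigEstimate}((\mathbf{A}^\top\mathbf{A})^tW)$ (with respect to $\mathbf{M}=\mathbf{A}^\top\mathbf{A}$), $\bar\lambda^{(0)}=\frac32\tilde\lambda^{(0)}_1$, $i=0$. While $\bar\lambda^{(i)}-\tilde\lambda^{(i)}_1<\frac1{10}(\bar\lambda^{(i)}-\tilde\lambda^{(i)}_2)$: set $i\leftarrow i+1$, draw a fresh Gaussian $W$, set $[\hat\lambda^{(i)}_1,\hat\lambda^{(i)}_2]=\mathrm{eigEstimate}((\bar\lambda^{(i-1)}\mathbf{I}-\mathbf{A}^\top\mathbf{A})^{-t}W)$ (with respect to $\mathbf{M}=(\bar\lambda^{(i-1)}\mathbf{I}-\mathbf{A}^\top\mathbf{A})^{-1}$), $\tilde\lambda^{(i)}_j=\bar\lambda^{(i-1)}-1/\hat\lambda^{(i)}_j$ for $j=1,2$, and $\bar\lambda^{(i)}=\frac12(\tilde\lambda^{(i)}_1+\bar\lambda^{(i-1)})$. Suppose $\alpha>100$ and the algorithm exits after $T$ iterations ($T$ the final value of $i$). Then $T\le\lceil\log\frac{10}{\mathrm{gap}}\rceil+1$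 and $$\left(1+\frac{\mathrm{gap}}{120}\right)\lambda_1\le\bar\lambda^{(T)}\le\left(1+\frac{\mathrm{gap}}8\right)\lambda_1.$$
   Context: For a matrix $\mathbf{M}$ and $\mathbf{Y}\in\mathbb{R}^{d\times2}$, $\mathrm{eigEstimate}(\mathbf{Y})$ returns $\tilde\lambda_i=\tilde v_i^\top\mathbf{M}\tilde v_i$ for $i=1,2$, where $\tilde v_i$ is the $i$-th top (left singular) eigenvector of $\mathbf{Y}$. Standing assumption used by the paper (a gap-free power method guarantee): there is a fixed constant $c$ such that for any $\mathbf{M}\in\mathbb{R}^{d\times d}$ with eigenvalues $\mu_1\ge\mu_2\ge\dots$, any $k\le d$, $\mathbf{W}\in\mathbb{R}^{d\times k}$ with i.i.d. $\mathcal{N}(0,1)$ entries and $t=c\alpha\log d$, $\alpha>1$, the values $[\tilde\lambda_1,\dots,\tilde\lambda_k]=\mathrm{eigEstimate}(\mathbf{M}^t\mathbf{W})$ satisfy $|\tilde\lambda_i-\mu_i|\le\frac1\alpha\mu_{k+1}$ for all $i$; the algorithm uses this $c$.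
   Formalization: The printed loop test, with ''<'', would stop at once with T = 0 and violate the upper bound; here the loop continues while the shift minus the first estimate is greater than one tenth of the shift minus the second. The logarithm in the bound on T is taken to base 2. *)

(* Defs.v *)
From HB Require Import structures.
From mathcomp Require Import all_boot all_order all_algebra.
From mathcomp Require Import all_classical all_reals all_analysis.

Set Implicit Arguments.
Unset Strict Implicit.
Unset Printing Implicit Defensive.

Import Order.TTheory GRing.Theory Num.Theory.
Local Open Scope ring_scope.

Definition log2 {R : realType} (x : R) : R := ln x / ln 2.

(* The number of power iterations t = c * alpha * log d, rounded up. The base
   of the logarithm only rescales the constant c. *)
Definition power_steps {R : realType} (c alpha : R) (d : nat) : nat :=
  `|Num.ceil (c * alpha * log2 d%:R)|%N.

(* mu lists the eigenvalues of M with multiplicity, largest first: the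
   (i+1)-st largest eigenvalue is mu`_i, and mu`_i = 0 for i >= d. *)
Definition eigenvalues {R : realType} {d : nat} (M : 'M[R]_d) (mu : seq R) :
    Prop :=
  sorted (fun x y => y <= x) mu /\ char_poly M = \prod_(x <- mu) ('X - x%:P).

Definition thin_svd {R : realType} {d k : nat} (Y : 'M[R]_(d, k))
    (U : 'M[R]_(d, k)) (s : 'rV[R]_k) (V : 'M[R]_k) : Prop :=
  [/\ U^T *m U = 1%:M, V^T *m V = 1%:M,
      forall i, 0 <= s 0 i,
      forall i j : 'I_k, (i <= j)%N -> s 0 j <= s 0 i
    & Y = U *m diag_mx s *m V^T].

(* The estimates are a relation, not a function of Y: singular vectors are only
   determined up to sign, and less than that if singular values coincide. *)
Definition eigEstimate {R : realType} {d k : nat} (M : 'M[R]_d)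
    (Y : 'M[R]_(d, k)) (est : 'rV[R]_k) : Prop :=
  exists U s V, thin_svd Y U s V /\
    forall i, est 0 i = ((col i U)^T *m M *m col i U) 0 0.

(* The conclusion of the gap-free power method guarantee for one call of
   eigEstimate with k columns. *)
Definition gap_free_accurate {R : realType} {d k : nat} (alpha : R)
    (M : 'M[R]_d) (est : 'rV[R]_k) : Prop :=
  forall mu, eigenvalues M mu ->
    forall i : 'I_k, `|est 0 i - mu`_i| <= alpha^-1 * mu`_k.

Definition shift_inv {R : realType} {n d : nat} (A : 'M[R]_(n, d)) (lbar : R) :
    'M[R]_d :=
  invmx (lbar%:M - A^T *m A).

(* The loop condition. The source prints this inequality as
     lbar - tl_1 < (lbar - tl_2) / 10,
   a misprint. At i = 0 the left side is tl_1 / 2, while the right side is at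
   most 3 tl_1 / 20 because tl_2 >= 0, so the printed loop would stop with T = 0
   and lbar^(0) = 3 tl_1 / 2, which violates the claimed upper bound. The loop
   has to shrink lbar until lbar - tl_1 is small compared with lbar - tl_2. *)
Definition keep_going {R : realType} (lbar : R) (tl : 'rV[R]_2) : Prop :=
  lbar - tl 0 0 > 1 / 10 * (lbar - tl 0 1).

(* A run of the algorithm on the draws W i that exits with i = T. *)
Record run {R : realType} {n d : nat} (A : 'M[R]_(n, d)) (t : nat)
    (W : nat -> 'M[R]_(d, 2)) (T : nat)
    (hl tl : nat -> 'rV[R]_2) (lbar : nat -> R) : Prop := Run {
  run_init_tl : eigEstimate (A^T *m A) ((A^T *m A) ^+ t *m W 0%N) (tl 0%N);
  run_init_lbar : lbar 0%N = 3 / 2 * tl 0%N 0 0;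
  run_loop : forall i, (i < T)%N -> keep_going (lbar i) (tl i);
  run_hl : forall i, (i < T)%N ->
    eigEstimate (shift_inv A (lbar i)) (shift_inv A (lbar i) ^+ t *m W i.+1)
      (hl i.+1);
  run_tl : forall i, (i < T)%N ->
    forall j, tl i.+1 0 j = lbar i - 1 / hl i.+1 0 j;
  run_lbar : forall i, (i < T)%N ->
    lbar i.+1 = 1 / 2 * (tl i.+1 0 0 + lbar i);
  run_exit : ~ keep_going (lbar T) (tl T)
}.

(* Every call of eigEstimate made by the run meets the power method guarantee.
   For Gaussian draws and finite t this is an event of high probability, not of
   probability one, so it is imposed on the outcome at hand. *)
Definition accurate_calls {R : realType} {n d : nat} (A : 'M[R]_(n, d))
    (alpha : R) (T : nat) (hl tl : nat -> 'rV[R]_2) (lbar : nat -> R) : Prop :=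
  gap_free_accurate alpha (A^T *m A) (tl 0%N) /\
  forall i, (i < T)%N -> gap_free_accurate alpha (shift_inv A (lbar i)) (hl i.+1).

Definition mutually_independent {R : realType} {disp : measure_display}
    {Omega : measurableType disp} (P : probability Omega R) {I : choiceType}
    (X : I -> {RV P >-> R}) : Prop :=
  forall (J : seq I) (B : I -> set R), uniq J ->
    (forall i, measurable (B i)) ->
    P (\bigcap_(i in [set` J]) (X i @^-1` B i))%classic =
      (\prod_(i <- J) P (X i @^-1` B i)%classic)%E.

Definition iid_std_normal {R : realType} {disp : measure_display}
    {Omega : measurableType disp} (P : probability Omega R) {I : choiceType}
    (X : I -> {RV P >-> R}) : Prop :=
  mutually_independent X /\
  forall i (B : set R), measurable B ->
    distribution P (X i) B = normal_prob 0 1 B.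

(* The realization at omega of the i-th draw; the entries of all the draws form
   a single family of random variables. *)
Definition draw {R : realType} {disp : measure_display}
    {Omega : measurableType disp} (P : probability Omega R) {d : nat}
    (X : nat * 'I_d * 'I_2 -> {RV P >-> R}) (omega : Omega) (i : nat) :
    'M[R]_(d, 2) :=
  \matrix_(a < d, b < 2) X (i, a, b) omega.

(* Main.v *)
(* Put x_i = lbar^(i) - lambda_1 and G = lambda_1 - lambda_2. A call on
   (lbar^(i) - A^T A)^-1 with relative error below 1/100 gives lbar^(i) - tl_j
   up to a factor in [100/101, 100/99] of lbar^(i) - lambda_j. For j = 1 the
   factor is even at least 1, because the estimate is a Rayleigh quotient and so
   does not exceed the top eigenvalue; hence x_(i+1) <= x_i / 2. Accuracy alone
   only gives a ratio above 1/2, which is not enough when gap is tiny. The loop test after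
   step i + 1 compares x_i with G: continuing forces x_i > G/5 and stopping
   forces x_i <= G/4. So x_T <= G/8, x_T is at least about G/20 if T >= 2, and
   2^(T-2) < (52/100) lambda_1 / (G/5) bounds T. *)
Require Import Defs.
From mathcomp Require Import all_boot all_order all_algebra.
From mathcomp Require Import all_classical all_reals all_analysis.
From mathcomp Require Import complex ring lra.

Set Implicit Arguments.
Unset Strict Implicit.
Unset Printing Implicit Defensive.

Import Order.TTheory GRing.Theory Num.Theory.
Local Open Scope ring_scope.

(** * Rayleigh quotients of real symmetric matrices *)

(** Over [R[i]] the matrix is Hermitian, so a unitary [P] diagonalises it with real eigenvalues. In
    the coordinates [w = P v] the form is a sum of eigenvalues weighted by squared moduli. *)
Lemma symmetric_quadratic_le (R : rcfType) (d : nat) (M : 'M[R]_d) (m : R)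
    (v : 'cV[R]_d) :
  M^T = M -> (forall x, root (char_poly M) x -> x <= m) ->
  (v^T *m M *m v) 0 0 <= m * (v^T *m v) 0 0.
Proof.
move=> symM le_m.
pose f : {rmorphism R -> R[i]} := real_complex R.
have f_conj x : Num.conj (f x) = f x.
  exact: conjc_real.
have f_le x y : (f x <= f y) = (x <= y) by rewrite /f /= lecR.
pose MC := map_mx f M.
have hermM : MC \is hermsymmx.
  apply: realsym_hermsym.
    by rewrite is_hermitianmxE scale1r map_mx_id // /MC map_trmx symM.
  by apply/mxOverP => i j; rewrite mxE; apply/CrealP; exact: f_conj.
have /orthomx_spectralP := hermitian_normalmx hermM.
have realD := hermitian_spectral_diag_real hermM.
set P := spectralmx MC; set D := spectral_diag MC => eM.
have unitaryP : P \is unitarymx by exact: spectral_unitarymx.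
have unitP : P \in unitmx by exact: unitarymx_unit.
rewrite invmx_unitary // in eM.
have D_le i : D 0 i <= f m.
  have /complex_realP[x Dx] : D 0 i \is Num.real by apply: (mxOverP realD).
  rewrite Dx -/(f x) f_le; apply: le_m.
  (* Row [i] of [P] is a left eigenvector for [D 0 i], nonzero because [P] is invertible. *)
  rewrite -(fmorph_root f) map_char_poly -/MC -eigenvalue_root_char.
  apply/eigenvalueP; exists (row i P); last first.
    apply/eqP => rP0; have := row_mul i P (invmx P).
    rewrite rP0 mul0mx mulmxV // => /rowP/(_ i).
    by rewrite !mxE eqxx => /eqP; rewrite oner_eq0.
  rewrite -row_mul eM !mulmxA (unitarymxP unitaryP) mul1mx row_mul.
  by rewrite row_diag_mx -scalemxAl -rowE Dx.
pose w : 'cV[R[i]]_d := P *m map_mx f v.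
have wE : map_mx Num.conj w^T = (map_mx f v)^T *m map_mx Num.conj P^T.
  rewrite trmx_mul map_mxM; congr (_ *m _).
  by apply/matrixP => i j; rewrite !mxE; exact: f_conj.
have wDw : f ((v^T *m M *m v) 0 0) = \sum_i D 0 i * (w i 0 * Num.conj (w i 0)).
  have -> : f ((v^T *m M *m v) 0 0) = (map_mx f (v^T *m M *m v)) 0 0.
    by rewrite [RHS]mxE.
  rewrite !map_mxM /= -/MC -[map_mx _ v^T]map_trmx eM !mulmxA -wE -mulmxA -/w.
  rewrite mxE; apply: eq_bigr => i _.
  by rewrite mul_mx_diag !mxE; ring.
have ww : f ((v^T *m v) 0 0) = \sum_i w i 0 * Num.conj (w i 0).
  have -> : f ((v^T *m v) 0 0) = (map_mx f (v^T *m v)) 0 0.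
    by rewrite [RHS]mxE.
  rewrite map_mxM -[map_mx _ v^T]map_trmx -[map_mx f v in X in _ *m X]mul1mx.
  rewrite -(mulVmx unitP) invmx_unitary // !mulmxA -wE.
  rewrite -mulmxA -/w mxE; apply: eq_bigr => i _.
  by rewrite !mxE mulrC.
rewrite -f_le rmorphM wDw ww mulr_sumr; apply: ler_sum => i _.
by apply: ler_wpM2r; [exact: mul_conjC_ge0 | exact: D_le].
Qed.

(** * Spectrum of the resolvent *)

(** The difference vanishes at 1, 2, 3, ..., at more points than its degree allows. Leaving out 0
    lets the resolvent computation divide by [x]. *)
Lemma poly_eq_horner (R : numDomainType) (p q : {poly R}) :
  (forall x, x != 0 -> p.[x] = q.[x]) -> p = q.
Proof.
move=> epq; apply/eqP; rewrite -subr_eq0; apply/eqP.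
pose rs := [seq (k.+1%:R : R) | k <- iota 0 (size (p - q))].
apply: (@roots_geq_poly_eq0 _ _ rs).
- apply/allP => _ /mapP[k _ ->].
  by rewrite rootE hornerD hornerN epq ?subrr // pnatr_eq0.
- by rewrite map_inj_uniq ?iota_uniq // => i j /eqP; rewrite eqr_nat => /eqP [].
- by rewrite size_map size_iota.
Qed.

Lemma horner_char_poly (R : comNzRingType) (d : nat) (M : 'M[R]_d) (x : R) :
  (char_poly M).[x] = \det (x%:M - M).
Proof.
rewrite -horner_evalE -det_map_mx; congr (\det _); apply/matrixP => i j.
by rewrite !mxE /= horner_evalE hornerD hornerN hornerMn hornerX hornerC.
Qed.

(* For x != 0, x - (b - M)^-1 = x (b - M)^-1 ((b - 1/x) - M). *)
Lemma char_poly_resolvent (R : numFieldType) (d : nat) (M : 'M[R]_d) (b : R)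
    (lam : seq R) :
  char_poly M = \prod_(x <- lam) ('X - x%:P) ->
  {in lam, forall x, x != b} ->
  b%:M - M \in unitmx /\
  char_poly (invmx (b%:M - M)) =
    \prod_(y <- [seq (b - x)^-1 | x <- lam]) ('X - y%:P).
Proof.
move=> eM lam_b.
have szlam : size lam = d.
  by apply/eq_add_S; rewrite -(size_char_poly M) eM size_prod_XsubC.
have hornerM x : (char_poly M).[x] = \prod_(y <- lam) (x - y).
  by rewrite eM horner_prod; apply: eq_bigr => y _; rewrite hornerXsubC.
have det0 : \prod_(y <- lam) (b - y) != 0.
  by rewrite prodf_seq_neq0; apply/allP => y /lam_b; rewrite subr_eq0 eq_sym.
have unitB : b%:M - M \in unitmx.
  by rewrite unitmxE -horner_char_poly hornerM unitfE.
split=> //; apply: poly_eq_horner => x x0.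
have factor : x%:M - invmx (b%:M - M) =
    x *: (invmx (b%:M - M) *m ((b - x^-1)%:M - M)).
  have -> : (b - x^-1)%:M - M = (b%:M - M) - x^-1%:M.
    by rewrite raddfB /= addrAC.
  rewrite mulmxBr mulVmx // mul_mx_scalar scalerBr scalerA mulfV // scale1r.
  by rewrite scalemx1.
rewrite horner_char_poly factor detZ det_mulmx det_inv.
rewrite -!horner_char_poly !hornerM horner_prod big_map.
(* Clear the determinant of [b%:M - M]; then [size lam = d] spreads [x ^+ d] over the product,
   leaving one identity per eigenvalue. *)
apply: (mulfI det0); rewrite mulrCA mulVKf //.
have -> : x ^+ d = \prod_(y <- lam) x.
  by rewrite big_const_seq count_predT iter_mulr_1 szlam.
rewrite -!big_split /= !big_seq; apply: eq_bigr => y /lam_b yb.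
rewrite hornerXsubC; field.
by rewrite subr_eq0 eq_sym yb x0.
Qed.

(** * Eigenvalue lists of Gram and shift-inverse matrices *)

Lemma root_char_poly_eigenvalues (R : realType) (d : nat) (M : 'M[R]_d)
    (mu : seq R) (x : R) :
  eigenvalues M mu -> root (char_poly M) x = (x \in mu).
Proof. by case=> _ ->; rewrite root_prod_XsubC. Qed.

Lemma size_eigenvalues (R : realType) (d : nat) (M : 'M[R]_d) (mu : seq R) :
  eigenvalues M mu -> size mu = d.
Proof.
by case=> _ eM; apply/eq_add_S; rewrite -(size_char_poly M) eM size_prod_XsubC.
Qed.

Lemma eigenvalues_le_head (R : realType) (d : nat) (M : 'M[R]_d) (mu : seq R)
    (x : R) :
  eigenvalues M mu -> x \in mu -> x <= mu`_0.
Proof.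
case=> + _; case: mu => //= y mu sorted_mu; rewrite inE => /orP[/eqP -> //|].
move: sorted_mu; rewrite path_sortedE; last exact: rev_trans le_trans.
by case/andP => /allP + _; apply.
Qed.

(** A left eigenvector [v] for [x] has [|v A^T|^2 = x |v|^2]. *)
Lemma gram_eigenvalues_ge0 (R : realType) (n d : nat) (A : 'M[R]_(n, d))
    (lam : seq R) (x : R) :
  eigenvalues (A^T *m A) lam -> x \in lam -> 0 <= x.
Proof.
move=> eA; rewrite -(root_char_poly_eigenvalues _ eA) -eigenvalue_root_char.
case/eigenvalueP => v vA v0.
have sqnorm m (w : 'rV[R]_m) : (w *m w^T) 0 0 = \sum_i w 0 i ^+ 2.
  by rewrite mxE; apply: eq_bigr => i _; rewrite mxE expr2.
have v_gt0 : 0 < (v *m v^T) 0 0.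
  rewrite lt_def sqnorm sumr_ge0 ?andbT => [|i _]; last exact: sqr_ge0.
  apply: contra v0; rewrite psumr_eq0 => [/allP v_eq0|i _]; last exact: sqr_ge0.
  apply/eqP/rowP => i; rewrite mxE; apply/eqP.
  by rewrite -sqrf_eq0; apply: v_eq0; rewrite mem_index_enum.
have : (v *m A^T *m (v *m A^T)^T) 0 0 = x * (v *m v^T) 0 0.
  by rewrite trmx_mul trmxK !mulmxA -(mulmxA v) vA -scalemxAl mxE.
rewrite sqnorm => eq_x; rewrite -(pmulr_lge0 _ v_gt0) -eq_x.
by apply: sumr_ge0 => i _; exact: sqr_ge0.
Qed.

(** Nonnegativity keeps the bound valid past the end of the list, where the default is 0; this
    covers a third eigenvalue when [d = 2]. *)
Lemma nonincreasing_nth0 (R : realDomainType) (s : seq R) (i j : nat) :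
  sorted (fun x y => y <= x) s -> {in s, forall x, 0 <= x} -> (i <= j)%N ->
  s`_j <= s`_i.
Proof.
move=> sorted_s s_ge0 le_ij; have [szs|lt_j] := leqP (size s) j.
  rewrite (nth_default _ szs); have [szi|lt_i] := leqP (size s) i.
    by rewrite nth_default.
  exact/s_ge0/mem_nth.
rewrite (@sorted_leq_nth _ (fun x y => y <= x)) ?inE //.
- exact: rev_trans le_trans.
- exact: leq_ltn_trans lt_j.
Qed.

(** Each estimate is the Rayleigh quotient of a column of [U], a unit vector since
    [U^T *m U = 1%:M]. *)
Lemma eigEstimate_le (R : realType) (d k : nat) (M : 'M[R]_d) (mu : seq R)
    (Y : 'M[R]_(d, k)) (est : 'rV[R]_k) (i : 'I_k) :
  M^T = M -> eigenvalues M mu -> eigEstimate M Y est -> est 0 i <= mu`_0.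
Proof.
move=> symM eM [U [s [V [[UU _ _ _ _] ->]]]].
have -> : mu`_0 = mu`_0 * ((col i U)^T *m col i U) 0 0.
  have -> : ((col i U)^T *m col i U) 0 0 = (U^T *m U) i i.
    by rewrite !mxE; apply: eq_bigr => a _; rewrite !mxE.
  by rewrite UU mxE eqxx mulr1.
apply: symmetric_quadratic_le => // x.
by rewrite (root_char_poly_eigenvalues _ eM); exact: eigenvalues_le_head eM.
Qed.

(** Below [b] the map sending [x] to [(b - x)^-1] is increasing, so the order of the list
    survives. *)
Lemma eigenvalues_shift_inv (R : realType) (n d : nat) (A : 'M[R]_(n, d))
    (lam : seq R) (b : R) :
  eigenvalues (A^T *m A) lam -> lam`_0 < b ->
  eigenvalues (shift_inv A b) [seq (b - x)^-1 | x <- lam].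
Proof.
move=> eA lt_b.
have lam_lt x : x \in lam -> x < b.
  by move=> /(eigenvalues_le_head eA) /le_lt_trans; apply.
case: (eA) => sorted_lam eq_lam.
have [x /lam_lt /lt_eqF -> //|_ eq_res] := char_poly_resolvent (b := b) eq_lam.
split; last exact: eq_res.
rewrite sorted_map.
apply: (@sub_in_sorted _ (mem lam) (fun x y => y <= x)) => //.
move=> x y /lam_lt x_lt /lam_lt y_lt le_yx /=.
by rewrite lef_pV2 ?posrE ?subr_gt0 // lerB.
Qed.

Lemma shift_inv_sym (R : realType) (n d : nat) (A : 'M[R]_(n, d)) (b : R) :
  (shift_inv A b)^T = shift_inv A b.
Proof.
by rewrite /shift_inv trmx_inv raddfB /= tr_scalar_mx trmx_mul trmxK.
Qed.

(** * One call and one iteration *)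

Lemma inv_relative_error (R : realFieldType) (alpha y h : R) :
  100 < alpha -> 0 < y -> `|h - y^-1| <= alpha^-1 * y^-1 ->
  0 < h /\ 100 / 101 * y <= h^-1 <= 100 / 99 * y.
Proof.
move=> lt_alpha y0 herr.
have y'0 : 0 < y^-1 by rewrite invr_gt0.
have : alpha^-1 * y^-1 <= 100^-1 * y^-1.
  by rewrite ler_pM2r // lef_pV2 ?posrE //; lra.
move=> /(le_trans herr); rewrite ler_norml => /andP[lo hi].
have h0 : 0 < h by lra.
have yne0 : y != 0 by rewrite gt_eqF.
split=> //.
have -> : 100 / 101 * y = (101 / 100 * y^-1)^-1 by field.
have -> : 100 / 99 * y = (99 / 100 * y^-1)^-1 by field.
by rewrite !lef_pV2 ?posrE //; lra.
Qed.

Lemma shift_inv_estimates (R : realType) (n d : nat) (A : 'M[R]_(n, d))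
    (lam : seq R) (alpha b : R) (Y : 'M[R]_(d, 2)) (h : 'rV[R]_2) :
  (2 <= d)%N -> eigenvalues (A^T *m A) lam -> 100 < alpha -> lam`_0 < b ->
  eigEstimate (shift_inv A b) Y h ->
  gap_free_accurate alpha (shift_inv A b) h ->
  b - lam`_0 <= (h 0 0)^-1 <= 100 / 99 * (b - lam`_0) /\
  100 / 101 * (b - lam`_1) <= (h 0 1)^-1 <= 100 / 99 * (b - lam`_1).
Proof.
move=> d2 eA lt_alpha lt_b est acc.
have size_lam := size_eigenvalues eA.
have eN := eigenvalues_shift_inv eA lt_b.
have lam_le i j : (i <= j)%N -> lam`_j <= lam`_i.
  apply: nonincreasing_nth0; first by case: eA.
  by move=> x; exact: gram_eigenvalues_ge0 eA.
set mu := [seq (b - x)^-1 | x <- lam] in eN.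
have muE i : (i < d)%N -> mu`_i = (b - lam`_i)^-1.
  by move=> lt_i; rewrite (nth_map 0) ?size_lam.
have gt0 i : 0 < b - lam`_i by have := lam_le 0%N i isT; lra.
(* The guarantee measures errors by the third eigenvalue (0 when [d = 2]); as it is at most the
   first two, the errors are relative. *)
have mu2_le i : (i < 2)%N -> mu`_2 <= (b - lam`_i)^-1.
  move=> lt_i; have [le_d|lt_d] := leqP d 2.
    by rewrite nth_default ?size_map ?size_lam // invr_ge0 ltW.
  by rewrite muE // lef_pV2 ?posrE // lerB // lam_le // ltnW.
have err (i : 'I_2) :
    `|h 0 i - (b - lam`_i)^-1| <= alpha^-1 * (b - lam`_i)^-1.
  rewrite -muE; last exact: leq_trans (ltn_ord i) d2.
  apply: (le_trans (acc _ eN i)); rewrite ler_pM2l ?invr_gt0; last by lra.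
  by rewrite muE ?mu2_le //; exact: leq_trans (ltn_ord i) d2.
have [h0 /andP[_ ->]] := inv_relative_error lt_alpha (gt0 0%N) (err 0).
have [_ ->] := inv_relative_error lt_alpha (gt0 1%N) (err 1).
(* Inverting the Rayleigh bound improves the lower factor from 100/101 to 1 for the top
   eigenvalue. *)
rewrite andbT; split=> //; have := eigEstimate_le 0 (shift_inv_sym A b) eN est.
rewrite muE ?(leq_trans _ d2) // => le_h.
by rewrite -[leLHS]invrK lef_pV2 ?posrE ?invr_gt0.
Qed.

(** Here [b'] is [b - 1 / (2 h_0)], and 49/99 is 1 - 50/99. The loop test amounts to
    [11 / (2 h_0) > 1 / h_1], linear in the inverse estimates. *)
Lemma iteration_step (R : realType) (n d : nat) (A : 'M[R]_(n, d))
    (lam : seq R) (alpha b b' : R) (Y : 'M[R]_(d, 2)) (h tl : 'rV[R]_2) :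
  (2 <= d)%N -> eigenvalues (A^T *m A) lam -> 100 < alpha -> lam`_0 < b ->
  eigEstimate (shift_inv A b) Y h ->
  gap_free_accurate alpha (shift_inv A b) h ->
  (forall j, tl 0 j = b - 1 / h 0 j) -> b' = 1 / 2 * (tl 0 0 + b) ->
  [/\ 49 / 99 * (b - lam`_0) <= b' - lam`_0 <= (b - lam`_0) / 2,
      keep_going b' tl -> (lam`_0 - lam`_1) / 5 < b - lam`_0
    & ~ keep_going b' tl -> b - lam`_0 <= (lam`_0 - lam`_1) / 4].
Proof.
move=> d2 eA lt_alpha lt_b est acc tlE ->.
have [/andP[lo0 hi0] /andP[lo1 hi1]] :=
  shift_inv_estimates d2 eA lt_alpha lt_b est acc.
rewrite /keep_going !tlE !mul1r; split.
- by apply/andP; split; lra.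
- lra.
- move/negP; rewrite -leNgt; lra.
Qed.

(** Both errors are at most [lam_0 / 100], so [b] lies between 1.485 and 1.515 times [lam_0]. The
    test passes because [b - tl_0 = tl_0 / 2], while [tl_1 >= 0] gives [b - tl_1 <= b]. *)
Lemma initial_estimates (R : realType) (n d : nat) (A : 'M[R]_(n, d))
    (lam : seq R) (alpha b : R) (tl : 'rV[R]_2) :
  eigenvalues (A^T *m A) lam -> 100 < alpha -> lam`_1 < lam`_0 ->
  gap_free_accurate alpha (A^T *m A) tl -> b = 3 / 2 * tl 0 0 ->
  48 / 100 * lam`_0 <= b - lam`_0 <= 52 / 100 * lam`_0 /\ keep_going b tl.
Proof.
move=> eA lt_alpha lt10 acc ->.
have lam_ge0 : {in lam, forall x, 0 <= x}.
  by move=> x; exact: gram_eigenvalues_ge0 eA.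
have lam_le i j : (i <= j)%N -> lam`_j <= lam`_i.
  by apply: nonincreasing_nth0 => //; case: eA.
have lam2_ge0 : 0 <= lam`_2.
  have [szlam|lt_2] := leqP (size lam) 2; first by rewrite nth_default.
  exact/lam_ge0/mem_nth.
have err i : `|tl 0 i - lam`_i| <= lam`_2 / 100.
  apply: (le_trans (acc _ eA i)); rewrite mulrC ler_wpM2l //.
  by rewrite lef_pV2 ?posrE //; lra.
have := err 0; have := err 1; rewrite !ler_norml /=.
move=> /andP[lo1 hi1] /andP[lo0 hi0].
have := lam_le 1%N 2%N isT; rewrite /keep_going => le21.
by split; [apply/andP; split; lra | lra].
Qed.

(** * Iteration count and final bounds *)

Lemma nat_le_log2 (R : realType) (k : nat) (x : R) :
  2 ^+ k <= x -> k%:R <= log2 x.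
Proof.
move=> le_x; have pow_gt0 : 0 < 2 ^+ k :> R by rewrite exprn_gt0.
have ln2_gt0 : 0 < ln 2 :> R by rewrite ln_gt0 // ltr1n.
rewrite /log2 ler_pdivlMr // mulr_natl -lnXn //.
by rewrite ler_ln ?posrE // (lt_le_trans pow_gt0).
Qed.

Theorem theorem6p4 (R : realType) (disp : measure_display)
  (Omega : measurableType disp) (P : probability Omega R)
  (n d : nat) (A : 'M[R]_(n, d)) (lam : seq R) (gap c alpha : R)
  (X : nat * 'I_d * 'I_2 -> {RV P >-> R})
  (hd : (2 <= d)%N)
  (hlam : eigenvalues (A^T *m A) lam)
  (hlam12 : lam`_1 < lam`_0)
  (hgap : gap = (lam`_0 - lam`_1) / lam`_0)
  (hc : 0 < c) (halpha : 100 < alpha)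
  (hX : iid_std_normal X)
  (omega : Omega) (T : nat) (hl tl : nat -> 'rV[R]_2) (lbar : nat -> R)
  (hrun : run A (power_steps c alpha d) (draw X omega) T hl tl lbar)
  (hacc : accurate_calls A alpha T hl tl lbar) :
  (T%:Z <= Num.ceil (log2 (10 / gap)) + 1)%R /\
  (1 + gap / 120) * lam`_0 <= lbar T <= (1 + gap / 8) * lam`_0.
Proof.
have lam1_ge0 : 0 <= lam`_1.
  by apply: (gram_eigenvalues_ge0 hlam); rewrite mem_nth ?(size_eigenvalues hlam).
have lam0_gt0 : 0 < lam`_0 by lra.
have gapE : gap * lam`_0 = lam`_0 - lam`_1 by rewrite hgap divfK // gt_eqF.
have gap_le : gap * lam`_0 <= lam`_0 by rewrite gapE; lra.
have gap_gt0 : 0 < gap by rewrite hgap divr_gt0 // subr_gt0.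
have gap_le1 : gap <= 1 by rewrite hgap ler_pdivrMr // mul1r; lra.
case: hrun hacc => _ lbar0 loop est_hl tlE lbarE stop [acc0 acc].
have [/andP[x0_lo x0_hi] go0] := initial_estimates hlam halpha hlam12 acc0 lbar0.
have step i (lt_iT : (i < T)%N) (lt_i : lam`_0 < lbar i) :=
  iteration_step hd hlam halpha lt_i (est_hl i lt_iT) (acc i lt_iT)
    (tlE i lt_iT) (lbarE i lt_iT).
(* The induction also carries [lam_0 < lbar i], since [step] needs a shift above the spectrum. *)
have decay i : (i <= T)%N ->
    lam`_0 < lbar i /\ 2 ^+ i * (lbar i - lam`_0) <= 52 / 100 * lam`_0.
  elim: i => [_|i IHi lt_iT]; first by rewrite expr0 mul1r; split; lra.
  have [lt_i le_i] := IHi (ltnW lt_iT).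
  have [/andP[lo hi] _ _] := step i lt_iT lt_i.
  split; first by lra.
  apply: le_trans le_i; rewrite exprSr -mulrA ler_pM2l ?exprn_gt0 //; lra.
(* The initial test passes, which rules out [T = 0]. *)
case: T => [|T'] in loop est_hl tlE lbarE stop acc step decay *.
  by case: stop.
have [lt_T' _] := decay T' (leqnSn _).
have [/andP[lo hi] _ /(_ stop) le_gap] := step T' (ltnSn _) lt_T'.
(* For [T = 1] the lower bound comes from [x_0 >= 48/100 lam_0], and the logarithm is nonnegative
   since [gap <= 1]. *)
case: T' => [|k] in loop est_hl tlE lbarE stop acc step decay lt_T' lo hi le_gap *.
  split; last by apply/andP; split; lra.
  rewrite -[leLHS]add0r lerD2r ceil_ge0; apply: (@lt_le_trans _ _ 0) => //.
  by apply: (@nat_le_log2 _ 0); rewrite expr0 ler_pdivlMr // mul1r; lra.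
have lt_k : (k < k.+2)%N by rewrite ltnS leqnSn.
have [lt_lbark le_k] := decay k (ltnW lt_k).
(* For [T = k + 2] the passed test at [k + 1] gives [x_k > G/5]; two steps keep a factor of at least
   [(49/99)^2]. *)
have [/andP[lo' hi'] /(_ (loop k.+1 (ltnSn _))) gt_gap _] := step k lt_k lt_lbark.
split; last by apply/andP; split; lra.
suff : (k.+1%:Z <= Num.ceil (log2 (10 / gap)))%R by rewrite -[k.+2]addn1 PoszD lerD2r.
rewrite -(ler_int R); apply: le_trans (ceil_ge _).
apply: nat_le_log2; rewrite ler_pdivlMr //.
have pow_gt0 : 0 < 2 ^+ k :> R by rewrite exprn_gt0.
(* Thus [2 ^+ k * gap <= 2.6], and doubling gives 5.2, below 10. *)
have le_pow : 2 ^+ k * (gap * lam`_0 / 5) <= 52 / 100 * lam`_0.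
  by apply: le_trans le_k; rewrite ler_pM2l // gapE ltW.
by rewrite exprS -(ler_pM2r lam0_gt0); lra.
Qed.
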